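(* Let $\overline{p}=(p_i)_{i\geq 1}$ be a sequence in $]0,1]$ and let $E:=\{z\in\mathbb{C}:(q_{F_n}(z))_{n\geq 0}\text{ is bounded}\}$. Suppose there exists $\delta>0$ such that $p_i>\delta$ for all $i\geq 1$. Then $E$ is compact and $\mathbb{C}\setminus E$ is connected.
   Context: The maps $q_{F_n}:\mathbb{C}\to\mathbb{C}$ (indexed by $n\geq 0$; here $(F_n)$ is the Fibonacci sequence $F_0=1$, $F_1=2$, $F_n=F_{n-1}+F_{n-2}$) are defined by $q_{F_0}(z)=\frac{z-(1-p_1)}{p_1}$, $q_{F_1}(z)=\frac{1}{p_2}(q_{F_0}(z))^2-\left(\frac{1}{p_2}-1\right)$ and $q_{F_n}(z)=\frac{1}{r_n}q_{F_{n-1}}(z)q_{F_{n-2}}(z)-\left(\frac{1}{r_n}-1\right)$ for $n\geq 2$, where $r_n=p_{\left[\frac{n+1}{2}\right]+1}$ and $[x]$ is the integer part of $x$. *)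

(* Defs.v *)
From mathcomp Require Import all_boot all_order all_algebra.
From mathcomp Require Import all_classical all_reals all_analysis.
From mathcomp Require Import complex.

Set Implicit Arguments.
Unset Strict Implicit.
Unset Printing Implicit Defensive.

Import Order.TTheory GRing.Theory Num.Theory.
Import numFieldNormedType.Exports.

Local Open Scope ring_scope.
Local Open Scope complex_scope.

(* R[i] itself has no canonical topology; as a numClosedFieldType it gets the
   one induced by the complex modulus. *)
Definition Cplx (R : realType) : numClosedFieldType := R[i].

Definition toC (R : realType) (x : R) : Cplx R := x%:C.

(* A sequence (p_i)_{i >= 1} is a function on nat whose value at 0 is never
   used below. *)
Definition r (R : realType) (p : nat -> R) (n : nat) : R :=
  p (n.+1 %/ 2).+1.

(* [qF p n] is the map q_{F_n}: the argument is the position n in the Fibonacci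
   sequence, not the Fibonacci number F_n. *)
Fixpoint qF (R : realType) (p : nat -> R) (n : nat) (z : Cplx R) : Cplx R :=
  match n with
  | 0 => (z - (1 - toC (p 1%N))) / toC (p 1%N)
  | n1.+1 =>
    match n1 with
    | 0 => 1 / toC (p 2%N) * qF p n1 z ^+ 2 - (1 / toC (p 2%N) - 1)
    | n2.+1 =>
      1 / toC (r p n) * qF p n1 z * qF p n2 z - (1 / toC (r p n) - 1)
    end
  end.

Definition E (R : realType) (p : nat -> R) : set (Cplx R) :=
  [set z | bounded_fun (fun n : nat => qF p n z)]%classic.

(* Main.v *)
Require Import Defs.
From mathcomp Require Import all_boot all_order all_algebra.
From mathcomp Require Import all_classical all_reals all_analysis.
From mathcomp Require Import complex.
From mathcomp Require Import separable cyclic cyclotomic ring lra.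

(** Write c = 2 / delta - 1 and q_n for the n-th map. With the convention
    q_(-1) = q_0, every step has the form q_(n+1) = (q_n q_(n-1) - (1 - s)) / s
    with delta < s <= 1. Such a step does not decrease a modulus that is at
    least 1: |q_n q_(n-1)| >= 1 gives |q_(n+1)| >= |q_n q_(n-1)|
    ([affine_step]). Hence an orbit with two consecutive moduli above 1 grows
    geometrically ([escape]). In a bounded orbit every modulus above 1 is thus
    isolated, and its product with the modulus before it is at most 1; the upper
    bound |q_(n+1)| <= (|q_n q_(n-1)| + 1) / delta - 1 then keeps every modulus
    at most c ([bounded_trap]). So E is the set where all the polynomials q_n
    have modulus at most c ([E_eq_poly_sublevel]), and q_0 alone makes it
    bounded.

    The theorem is therefore an instance of a fact on any family of complex
    polynomials ([compact_connectedC_poly_sublevel]): if the set K where all of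
    them are bounded by c is bounded, then it is compact and its complement is
    connected. Compactness is Heine-Borel. For the complement, the maximum
    principle forbids bounded pieces: a nonempty bounded open W, relatively
    closed in the complement of K, would contain a point where some polynomial P
    has |P| > c, while |P| <= c on the boundary of W, which lies in K
    ([no_bounded_piece]). Since the outside of a large square is connected and
    misses K, one of the two parts of any separation of the complement would be
    bounded.

    The maximum principle is obtained without integration: the average of a
    polynomial over the vertices of a regular n-gon centred at z is its value at
    z as soon as n exceeds the degree ([poly_mean_value]). *)

Import Order.TTheory GRing.Theory Num.Theory.
Import numFieldNormedType.Exports.

Set Implicit Arguments.
Unset Strict Implicit.
Unset Printing Implicit Defensive.

Local Open Scope classical_set_scope.
Local Open Scope ring_scope.

(** * The complex modulus as a real number *)

Definition re (R : realType) (z : Cplx R) : R := complex.Re z.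
Definition im (R : realType) (z : Cplx R) : R := complex.Im z.

(** The norm of [Cplx R] takes its values in [Cplx R], whose order is partial;
    the real-valued modulus restores a total order and real arithmetic. *)
Definition cmod (R : realType) (z : Cplx R) : R := re `|z|.

Lemma reD (R : realType) (z w : Cplx R) : re (z + w) = re z + re w.
Proof. by case: z => a b; case: w => c d. Qed.

Lemma re_sum (R : realType) (I : Type) (s : seq I) (F : I -> Cplx R) :
  re (\sum_(i <- s) F i) = \sum_(i <- s) re (F i).
Proof. by rewrite (big_morph (@re R) (@reD R) (erefl : re 0 = 0)). Qed.

Lemma toC_cmod (R : realType) (z : Cplx R) : toC (cmod z) = `|z|.
Proof. exact/RRe_real/normr_real. Qed.

Lemma toC_le (R : realType) (x y : R) : (toC x <= toC y) = (x <= y).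
Proof. exact: lecR. Qed.

Lemma toC_lt (R : realType) (x y : R) : (toC x < toC y) = (x < y).
Proof. exact: ltcR. Qed.

Lemma toCD (R : realType) (x y : R) : toC (x + y) = toC x + toC y.
Proof. exact: (rmorphD (real_complex R)). Qed.

Lemma toCM (R : realType) (x y : R) : toC (x * y) = toC x * toC y.
Proof. exact: (rmorphM (real_complex R)). Qed.

Lemma cmod_ge0 (R : realType) (z : Cplx R) : 0 <= cmod z.
Proof. by rewrite -toC_le toC_cmod; exact: normr_ge0. Qed.

Lemma cmodD (R : realType) (z w : Cplx R) : cmod (z + w) <= cmod z + cmod w.
Proof. by rewrite -toC_le toCD !toC_cmod; exact: ler_normD. Qed.

Lemma cmodM (R : realType) (z w : Cplx R) : cmod (z * w) = cmod z * cmod w.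
Proof. by apply: complexI; rewrite -!/(toC _) toCM !toC_cmod normrM. Qed.

Lemma cmodN (R : realType) (z : Cplx R) : cmod (- z) = cmod z.
Proof. by rewrite /cmod normrN. Qed.

Lemma cmod_toC (R : realType) (x : R) : cmod (toC x) = `|x|.
Proof. by rewrite /cmod normc_def /= expr0n /= addr0 sqrtr_sqr. Qed.

Lemma ler_re_cmod (R : realType) (z : Cplx R) : `|re z| <= cmod z.
Proof. by rewrite -toC_le toC_cmod; exact: normc_ge_Re. Qed.

Lemma ler_im_cmod (R : realType) (z : Cplx R) : `|im z| <= cmod z.
Proof.
case: z => a b; rewrite /cmod normc_def /im /re /= -sqrtr_sqr ler_wsqrtr //.
by rewrite lerDr sqr_ge0.
Qed.

Lemma cmod_le_re_im (R : realType) (z : Cplx R) : cmod z <= `|re z| + `|im z|.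
Proof.
case: z => a b; rewrite /cmod normc_def /im /re /=.
rewrite -(@ler_pXn2r _ 2) ?nnegrE ?sqrtr_ge0 ?addr_ge0 //.
rewrite sqr_sqrtr ?addr_ge0 ?sqr_ge0 // sqrrD !real_normK ?num_real //.
by rewrite addrAC lerDl mulrn_wge0 // mulr_ge0.
Qed.

Lemma cmod_sum (R : realType) (I : Type) (s : seq I) (F : I -> Cplx R) :
  cmod (\sum_(i <- s) F i) <= \sum_(i <- s) cmod (F i).
Proof.
elim/big_rec2: _ => [|i x y _ le_yx]; first by rewrite /cmod normr0.
by rewrite (le_trans (cmodD _ _)) // lerD2l.
Qed.

(** The radii of the balls that generate the topology are positive elements of
    [Cplx R], hence real: neighbourhoods can be tested with real radii. *)
Lemma nbhs_cmodP (R : realType) (z : Cplx R) (A : set (Cplx R)) :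
  nbhs z A <-> exists2 e : R, 0 < e & forall w, cmod (z - w) < e -> A w.
Proof.
split=> [/nbhs_ballP[e e0 eA]|[e e0 eA]].
  have e_real : toC (re e) = e by apply: RRe_real; exact: gtr0_real.
  exists (re e); first by rewrite -toC_lt e_real.
  by move=> w; rewrite -toC_lt toC_cmod e_real => zw; exact: eA.
apply/nbhs_ballP; exists (toC e); first by rewrite /= -[0]/(toC 0) toC_lt.
by move=> w; rewrite -ball_normE /= -toC_cmod toC_lt; exact: eA.
Qed.

(** * Orbits of the modulus recursion *)

(** If c > 1 is the smaller of the two terms, each later one is at least c times
    its predecessor. As [0.-1] is [0], the case [n = 0] of [grow] concerns
    [a 0 * a 0]: this is the recursion with q_(-1) = q_0. *)
Lemma escape (R : realType) (a : nat -> R)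
    (grow : forall n, 1 <= a n * a n.-1 -> a n * a n.-1 <= a n.+1) (n : nat) :
  1 < a n -> 1 < a n.+1 -> forall B, exists m, B < a m.
Proof.
move=> an1 an1' B; pose c := Num.min (a n) (a n.+1).
have c1 : 1 < c by rewrite lt_min an1.
have step k : 1 < c <= a (n + k)%N -> c <= a (n + k).+1 ->
    c * a (n + k).+1 <= a (n + k).+2.
  move=> /andP[_ ck] ck'.
  have cc : c * a (n + k).+1 <= a (n + k).+1 * a (n + k)%N.
    by rewrite mulrC ler_wpM2l //; lra.
  apply: (le_trans cc); apply: grow; apply: le_trans cc.
  by rewrite -[leLHS]mulr1 ler_pM //; lra.
(* Bernoulli's linear lower bound is enough to exceed any [B]. *)
have lin k : c <= a (n + k)%N /\ 1 + k%:R * (c - 1) <= a (n + k).+1 /\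
    c <= a (n + k).+1.
  elim: k => [|k [IH1 [IH2 IH3]]].
    rewrite addn0 mul0r addr0 !ge_min !lexx orbT.
    by split=> //; split=> //; lra.
  have := step k; rewrite c1 IH1 addnS => /(_ isT IH3) h.
  have h2 : 0 <= k%:R * (c - 1) by rewrite mulr_ge0 //; lra.
  split=> //; rewrite -natr1; split; nra.
exists (n + Num.bound (`|B| / (c - 1))).+1.
have [_ [+ _]] := lin (Num.bound (`|B| / (c - 1))).
have : `|B| / (c - 1) < (Num.bound (`|B| / (c - 1)))%:R.
  by apply: archi_boundP; rewrite divr_ge0 //; lra.
rewrite ltr_pdivrMr; last by lra.
by have := ler_norm B; lra.
Qed.

(** By [escape], a term above 1 has both neighbours at most 1. If
    [a n.+1] were the first to exceed [2 * K - 1], then [a n * a n.-1] would be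
    at most [a n * a n.+1], which is at most 1 because otherwise [grow] would
    put [a n.+2] above 1 too; [control] then bounds [a n.+1] by [2 * K - 1]. *)
Lemma bounded_trap (R : realType) (a : nat -> R) (K : R)
    (a0 : forall n, 0 <= a n)
    (grow : forall n, 1 <= a n * a n.-1 -> a n * a n.-1 <= a n.+1)
    (control : forall n, a n.+1 <= K * (a n * a n.-1 + 1) - 1) :
  1 <= K -> (exists B, forall n, a n <= B) -> forall n, a n <= 2 * K - 1.
Proof.
move=> K1 [B aB].
have no_two n : ~ (1 < a n /\ 1 < a n.+1).
  move=> [h1 h2]; have [m] := escape grow h1 h2 B.
  by rewrite ltNge aB.
(* The two previous terms are needed together, as the step uses both. *)
suff H n : a n.-1 <= 2 * K - 1 /\ a n <= 2 * K - 1 by move=> n; case: (H n).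
elim: n => [|n [IH1 IH2]] /=.
  suff : a 0%N <= 1 by move=> h; split; lra.
  rewrite leNgt; apply/negP => h; apply: (no_two 0%N); split=> //.
  by have /= := grow 0%N; nra.
split=> //; rewrite leNgt; apply/negP => big.
have an1 : a n <= 1.
  by rewrite leNgt; apply/negP => h; apply: (no_two n); split=> //; lra.
have prod1 : a n.+1 * a n <= 1.
  rewrite leNgt; apply/negP => h; apply: (no_two n.+1); split; first lra.
  by apply: (lt_le_trans h); exact: grow (ltW h).
have prod2 : a n * a n.-1 <= 1.
  by apply: le_trans prod1; rewrite mulrC ler_wpM2r //; lra.
have := control n; have : K * (a n * a n.-1 + 1) <= K * 2.
  by rewrite ler_wpM2l //; lra.
lra.
Qed.

(** * Continuity and compactness in the complex plane *)

Lemma continuous_contraction (R : realType) (f : Cplx R -> R) :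
  (forall z w, `|f z - f w| <= cmod (z - w)) -> continuous f.
Proof.
move=> f1 z N /nbhs_ballP[e e0 eN]; apply/nbhs_cmodP; exists e => // w zw.
by apply: eN; apply: le_lt_trans zw; exact: f1.
Qed.

Lemma continuous_cmod (R : realType) : continuous (@cmod R).
Proof.
apply: continuous_contraction => z w.
have := cmodD (z - w) w; have := cmodD (- (z - w)) z.
rewrite cmodN subrK opprB subrK ler_norml => ? ?.
by apply/andP; split; lra.
Qed.

Lemma continuous_re (R : realType) : continuous (@re R).
Proof.
apply: continuous_contraction => z w; rewrite (_ : re z - re w = re (z - w)).
  exact: ler_re_cmod.
by case: z w => [a b] [c d].
Qed.

Lemma continuous_poly (K : numFieldType) (P : {poly K}) : continuous (horner P).
Proof.
elim/poly_ind: P => [|P c IH].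
  have -> : horner (0 : {poly K}) = cst 0 by apply/funext => x; rewrite horner0.
  exact: cst_continuous.
have -> : horner (P * 'X + c%:P) = (horner P \* id) \+ cst c.
  by apply/funext => x; rewrite hornerMXaddC.
move=> z; have cPX : {for z, continuous (horner P \* id)}.
  by apply: continuousM; [exact: IH | exact: cvg_id].
exact: cvgD cPX (@cst_continuous _ _ c z).
Qed.

(** Heine-Borel: a bounded set lies in the continuous image of a compact square
    of [R * R]. *)
Lemma compact_closed_bounded (R : realType) (A : set (Cplx R)) (B : R) :
  closed A -> (forall z, A z -> cmod z <= B) -> compact A.
Proof.
move=> clA AB; pose f (x : R * R) : Cplx R := Complex x.1 x.2.
have cf : continuous f.
  move=> [x y] N /nbhs_cmodP[e e0 eN].
  have e2 : 0 < e / 2 by rewrite divr_gt0.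
  exists (ball x (e / 2), ball y (e / 2)); first by split; exact: nbhsx_ballx.
  move=> [x' y'] []; rewrite /ball /= => hx hy; apply: eN.
  apply: le_lt_trans (cmod_le_re_im _) _; rewrite /f /=; lra.
apply: (@subclosed_compact _ _ (f @` (`[- B, B] `*` `[- B, B]))) => //.
  apply: continuous_compact; first exact: continuous_subspaceT.
  by apply: compact_setX; exact: segment_compact.
move=> z /AB zB; exists (re z, im z); last by case: z zB.
by split; rewrite /= in_itv /= -ler_norml;
  apply: le_trans zB; [exact: ler_re_cmod | exact: ler_im_cmod].
Qed.

(** * The maximum principle for polynomials *)

(** ['X^n - 1] is separable when [n] is invertible, so its [n] roots are
    distinct, and a finite group of roots of unity is cyclic. *)
Lemma prim_root_exists (F : closedFieldType) (n : nat) :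
  n%:R != 0 :> F -> exists w : F, n.-primitive_root w.
Proof.
move=> n0; have n_gt0 : (0 < n)%N by case: n n0 => //; rewrite eqxx.
have [s Ds] := closed_field_poly_normal ('X^n - 1 : {poly F}).
rewrite (monicP _) ?monicXnsubC // scale1r in Ds.
have sn1 : all n.-unity_root s.
  by apply/allP => z; rewrite -root_prod_XsubC -Ds.
have sz_s : (n <= size s)%N.
  by rewrite -ltnS -(size_prod_XsubC s id) -Ds size_XnsubC.
have [|w] := hasP (has_prim_root n_gt0 sn1 _ sz_s); last by exists w.
by rewrite -separable_prod_XsubC -Ds separable_Xn_sub_1.
Qed.

Lemma sum_prim_root_expr (F : fieldType) (n : nat) (w : F) (i : nat) :
  n.-primitive_root w -> (0 < i < n)%N -> \sum_(j < n) (w ^+ j) ^+ i = 0.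
Proof.
move=> prim_w /andP[i0 i_n].
have wi1 : w ^+ i - 1 != 0.
  rewrite subr_eq0 -(prim_order_dvd prim_w).
  by apply/negP => /dvdn_leq -/(_ i0); rewrite leqNgt i_n.
apply: (mulfI wi1); rewrite mulr0.
under eq_bigr do rewrite exprAC.
by rewrite -subrX1 exprAC (prim_expr_order prim_w) expr1n subrr.
Qed.

(** A discrete Cauchy formula: in the expansion of [P] at [z], the powers of
    [w] sum to zero in every degree strictly between [0] and [n], and only the
    constant term survives. *)
Lemma poly_mean_value (F : fieldType) (n : nat) (w z h : F) (P : {poly F}) :
  n.-primitive_root w -> (size P <= n)%N ->
  \sum_(j < n) P.[z + h * w ^+ j] = P.[z] *+ n.
Proof.
move=> prim_w szP; pose Q := P \Po ('X + z%:P).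
have n0 := prim_order_gt0 prim_w.
have szQ : (size Q <= n)%N by rewrite size_comp_poly2 // size_XaddC.
have evQ x : P.[z + x] = Q.[x] by rewrite horner_comp !hornerE addrC.
rewrite -[in RHS](addr0 z) evQ horner_coef0.
under eq_bigr do rewrite evQ (horner_coef_wide _ szQ).
rewrite exchange_big /= (bigD1 (Ordinal n0)) //= [X in _ + X]big1 => [|i i0].
  under eq_bigr do rewrite expr0 mulr1.
  by rewrite addr0 sumr_const card_ord.
under eq_bigr do rewrite exprMn mulrA.
by rewrite -mulr_sumr sum_prim_root_expr ?mulr0 // ltn_ord andbT lt0n.
Qed.

(** [cmod P] is only weakly subharmonic, and constant polynomials reach their
    maximum everywhere. Adding [eps * re z ^+ 2], whose mean over the vertices
    of a regular polygon with a vertex at [z + h] strictly exceeds its value at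
    the centre, excludes interior maxima. *)
Lemma strict_submean (R : realType) (P : {poly Cplx R}) (eps h : R)
    (z : Cplx R) : 0 < eps -> 0 < h ->
  exists2 u : Cplx R, cmod u = h &
    cmod P.[z] + eps * re z ^+ 2 < cmod P.[z + u] + eps * re (z + u) ^+ 2.
Proof.
move=> eps0 h0.
(* At least two vertices are needed for the linear terms in the expansion
   of [re (z + u) ^+ 2] to cancel. *)
have [n szP n2] : exists2 n, (size P <= n)%N & (1 < n)%N.
  by exists (size P).+2; rewrite // !leqW.
have [w prim_w] : exists w : Cplx R, n.-primitive_root w.
  by apply: prim_root_exists; rewrite pnatr_eq0 -lt0n ltnW.
pose u (j : 'I_n) : Cplx R := toC h * w ^+ j.
have cu j : cmod (u j) = h.
  have w1 : `|w| = 1.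
    apply/eqP; rewrite -(@pexpr_eq1 _ _ n) ?(ltnW n2) // -normrX.
    by rewrite (prim_expr_order prim_w) normr1.
  by rewrite cmodM cmod_toC gtr0_norm // /cmod normrX w1 expr1n mulr1.
case: (pselect (exists j, cmod P.[z] + eps * re z ^+ 2 <
    cmod P.[z + u j] + eps * re (z + u j) ^+ 2)) => [[j hj]|/forallNP none].
  by exists (u j).
have le_f j : cmod P.[z + u j] + eps * re (z + u j) ^+ 2 <=
    cmod P.[z] + eps * re z ^+ 2 by rewrite leNgt; apply/negP/none.
have : \sum_(j < n) (cmod P.[z + u j] + eps * re (z + u j) ^+ 2) <=
    \sum_(j < n) (cmod P.[z] + eps * re z ^+ 2) by apply: ler_sum.
have meanP : cmod P.[z] *+ n <= \sum_(j < n) cmod P.[z + u j].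
  have := @cmod_sum R _ (index_enum 'I_n) (fun j => P.[z + u j]).
  rewrite (poly_mean_value _ _ prim_w szP).
  have cn : cmod (n%:R : Cplx R) = n%:R.
    by rewrite -(rmorph_nat (real_complex R)) -/(toC _) cmod_toC normr_nat.
  by rewrite -mulr_natl cmodM cn mulr_natl.
have sum_u : \sum_(j < n) re (u j) = 0.
  rewrite -re_sum -mulr_sumr.
  under eq_bigr do rewrite -[w ^+ _]expr1.
  by rewrite (sum_prim_root_expr prim_w) // mulr0.
have sum_u2 : h ^+ 2 <= \sum_(j < n) re (u j) ^+ 2.
  pose j0 := Ordinal (ltnW n2).
  have u0 : re (u j0) = h by rewrite /u expr0 mulr1.
  rewrite (bigD1 j0) // u0 lerDl.
  by apply: sumr_ge0 => j _; exact: sqr_ge0.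
have sum_re : \sum_(j < n) re (z + u j) ^+ 2 =
    re z ^+ 2 *+ n + \sum_(j < n) re (u j) ^+ 2.
  under eq_bigr do rewrite reD sqrrD -mulrnAl.
  rewrite !big_split /= -[X in _ + X + _ = _]mulr_sumr sum_u mulr0 addr0.
  by rewrite sumr_const card_ord.
rewrite big_split /= -mulr_sumr sum_re sumr_const card_ord mulrnDl.
have : 0 < eps * h ^+ 2 by rewrite mulr_gt0 ?exprn_gt0.
have : eps * h ^+ 2 <= eps * \sum_(j < n) re (u j) ^+ 2 by rewrite ler_pM2l.
rewrite mulrDr mulrnAr; lra.
Qed.

(** * Connectedness outside a square *)

(** Stated with segments, so that the convexity of a half-plane is a direct
    computation on coordinates. *)
Lemma connected_convex (R : realType) (A : set (Cplx R)) :
  (forall (z w : Cplx R) (t : R), A z -> A w -> 0 <= t <= 1 ->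
    A (z + toC t * (w - z))) -> connected A.
Proof.
move=> cvxA; have [->|/set0P[c Ac]] := eqVneq A set0; first exact: connected0.
pose seg w := (fun t : R => c + toC t * (w - c)) @` `[0, 1].
have -> : A = \bigcup_(w in A) seg w.
  apply/seteqP; split=> [w Aw|_ [w Aw [t t01 <-]]]; last exact: cvxA.
  exists w => //; exists 1; first by rewrite /= in_itv /= ler01 lexx.
  by rewrite (_ : toC 1 = 1) // mul1r addrC subrK.
apply: bigcup_connected => [|w Aw].
  exists c => w Aw; exists 0; first by rewrite /= in_itv /= ler01 lexx.
  by rewrite (_ : toC 0 = 0) // mul0r addr0.
apply: connected_continuous_connected; first exact: segment_connected.
apply: continuous_subspaceT => t N /nbhs_cmodP[e e0 eN].
have d0 : 0 < cmod (w - c) + 1 by rewrite ltr_wpDl ?cmod_ge0.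
exists (e / (cmod (w - c) + 1)); first by rewrite /= divr_gt0.
move=> s; rewrite /= ltr_pdivlMr // => ts; apply: eN.
rewrite opprD addrACA subrr add0r -mulrBl cmodM.
have -> : toC t - toC s = toC (t - s) by rewrite /toC -rmorphB.
rewrite cmod_toC; apply: le_lt_trans ts; rewrite ler_wpM2l //; lra.
Qed.

(** A union of four half-planes, each meeting the next one, is connected
    without the polar coordinates that the outside of a disk would call for. *)
Definition outside_square (R : realType) (B : R) : set (Cplx R) :=
  [set z | B < re z] `|` [set z | B < im z] `|` [set z | re z < - B]
  `|` [set z | im z < - B].

Lemma connected_outside_square (R : realType) (B : R) :
  0 <= B -> connected (outside_square B).
Proof.
move=> B0.
have reE (z w : Cplx R) t : re (z + toC t * (w - z)) = re z + t * (re w - re z).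
  by case: z w => [a b] [c d]; rewrite /re /=; ring.
have imE (z w : Cplx R) t : im (z + toC t * (w - z)) = im z + t * (im w - im z).
  by case: z w => [a b] [c d]; rewrite /im /=; ring.
have cvx (a x y t : R) : a < x -> a < y -> 0 <= t <= 1 -> a < x + t * (y - x).
  by move=> ax ay /andP[t0 t1]; have [?|?] := leP x y; nra.
have cvxN (a x y t : R) : x < a -> y < a -> 0 <= t <= 1 -> x + t * (y - x) < a.
  by move=> ax ay /andP[t0 t1]; have [?|?] := leP x y; nra.
apply: connectedU; first exists (Complex (- (B + 1)) (- (B + 1))).
- by rewrite /outside_square /re /im /=; split; [right|]; lra.
- apply: connectedU; first exists (Complex (- (B + 1)) (B + 1)).
  + by rewrite /re /im /=; split; [right|]; lra.
  + apply: connectedU; first exists (Complex (B + 1) (B + 1)).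
    * by rewrite /re /im /=; split; lra.
    * by apply: connected_convex => z w t /= zB wB t01; rewrite reE; auto.
    * by apply: connected_convex => z w t /= zB wB t01; rewrite imE; auto.
  + by apply: connected_convex => z w t /= zB wB t01; rewrite reE; auto.
- by apply: connected_convex => z w t /= zB wB t01; rewrite imE; auto.
Qed.

(** * Sublevel sets of a family of polynomials *)

Definition poly_sublevel (R : realType) (I : Type) (P : I -> {poly Cplx R})
    (C : R) : set (Cplx R) :=
  [set z | forall i, cmod (P i).[z] <= C].

Lemma closed_poly_sublevel (R : realType) (I : Type) (P : I -> {poly Cplx R})
    (C : R) :
  closed (poly_sublevel P C).
Proof.
have -> : poly_sublevel P C =
    \bigcap_(i in [set: I]) ((@cmod R \o horner (P i)) @^-1` [set x | x <= C]).
  by apply/seteqP; split=> [z zK i _|z zK i]; [exact: zK | exact: zK].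
apply: closed_bigI => i _; apply: preimage_closed; last exact: closed_le.
move=> z _; apply: continuous_comp; first exact: continuous_poly.
exact: continuous_cmod.
Qed.

(** The points of [D] that this open set omits, among them its boundary points,
    lie in the sublevel set, where every [cmod (P i).[z]] is at most [C]. Over
    [D] cut by a disk, which is compact, a maximum that exceeds [C] is thus
    attained in the open set, against [strict_submean]. *)
Lemma no_bounded_piece (R : realType) (I : Type) (P : I -> {poly Cplx R})
    (C B : R) (D : set (Cplx R)) :
  closed D -> open (~` poly_sublevel P C `&` D) ->
  (forall z, (~` poly_sublevel P C `&` D) z -> cmod z <= B) ->
  ~` poly_sublevel P C `&` D = set0.
Proof.
set W := _ `&` D => clD opW WB; apply/eqP/negPn/negP => /set0P[z Wz].
have [i /negP] : exists i, ~ cmod (P i).[z] <= C.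
  by apply/existsNP; case: Wz.
rewrite -ltNge => Cz.
have B0 : 0 <= B := le_trans (cmod_ge0 z) (WB _ Wz).
(* [eps * B ^+ 2] stays below the excess of [cmod P] over [C] at [z], so that
   the perturbation cannot move the maximum to the boundary. *)
pose eps := (cmod (P i).[z] - C) / (B ^+ 2 + 1).
have B1 : 0 < B ^+ 2 + 1 by rewrite ltr_wpDl ?sqr_ge0.
have eps0 : 0 < eps by rewrite divr_gt0 // subr_gt0.
have epsE : eps * (B ^+ 2 + 1) = cmod (P i).[z] - C.
  by rewrite divfK // gt_eqF.
pose f x := cmod (P i).[x] + eps * re x ^+ 2.
have cf : continuous f.
  have c1 : continuous (@cmod R \o horner (P i)).
    move=> x; apply: continuous_comp; first exact: continuous_poly.
    exact: continuous_cmod.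
  move=> x; have c2 : {for x, continuous (@re R \* @re R)}.
    by apply: continuousM; exact: continuous_re.
  have c3 : {for x, continuous (cst eps \* (@re R \* @re R))}.
    by apply: continuousM => //; exact: cst_continuous.
  exact: cvgD (c1 x) c3.
pose K := D `&` [set x : Cplx R | cmod x <= B].
have cK : compact K.
  apply: (@compact_closed_bounded _ _ B) => [|x []//].
  apply: closedI => //.
  apply: (@preimage_closed _ _ (@cmod R) [set x | x <= B]).
    by move=> x _; exact: continuous_cmod.
  exact: closed_le.
have WK : W `<=` K by move=> x Wx; split; [case: Wx | exact: WB].
have [z0 /set_mem[Dz0 Bz0] max0] : exists2 c, c \in K &
    forall t, t \in K -> f t <= f c.
  apply: compact_EVT_max => //; first by exists z; exact: WK.
  exact: continuous_subspaceT.
have Wz0 : W z0.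
  split=> // /(_ i) small.
  have := max0 z (mem_set (WK _ Wz)); apply/negP; rewrite -ltNge /f.
  have : re z0 ^+ 2 <= B ^+ 2.
    rewrite -real_normK ?num_real // ler_pXn2r ?nnegrE //.
    exact: le_trans (ler_re_cmod _) Bz0.
  have : 0 <= re z ^+ 2 by exact: sqr_ge0.
  nra.
have /nbhs_cmodP[e e0 eW] : nbhs z0 W by exact: open_nbhs_nbhs.
have e2 : 0 < e / 2 by rewrite divr_gt0.
have [u cu] := strict_submean (P i) z0 eps0 e2.
apply/negP; rewrite -leNgt; apply: max0; apply/mem_set/WK/eW.
by rewrite opprD addrA subrr add0r cmodN cu; lra.
Qed.

(** A relatively clopen part [A] of the complement either contains or misses
    the outside of a large square. So either its complementary part or [A]
    itself is bounded, and [no_bounded_piece] says that this one is empty. *)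
Theorem compact_connectedC_poly_sublevel (R : realType) (I : Type)
    (P : I -> {poly Cplx R}) (C B : R) :
  (forall z, poly_sublevel P C z -> cmod z <= B) ->
  compact (poly_sublevel P C) /\ connected (~` poly_sublevel P C).
Proof.
move=> KB; have clK := @closed_poly_sublevel R I P C.
split; first exact: compact_closed_bounded KB.
set K := poly_sublevel P C in KB clK *.
have opK : open (~` K) by exact: closed_openC.
pose B' := Num.max B 0; have B'0 : 0 <= B' by rewrite le_max lexx orbT.
have BB' : B <= B' by rewrite le_max lexx.
pose X : set (Cplx R) := outside_square B'.
have XK : X `<=` ~` K.
  move=> z Xz /KB zB.
  have := le_trans (ler_re_cmod z) zB; have := le_trans (ler_im_cmod z) zB.
  rewrite !ler_norml => /andP[? ?] /andP[? ?].
  by move: Xz => [[[]|]|] /=; lra.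
have bounded_of z : ~ X z -> cmod z <= B' + B'.
  move=> nXz; apply: le_trans (cmod_le_re_im z) _.
  by apply: lerD; rewrite ler_norml; apply/andP; split; rewrite leNgt;
    apply/negP => h; apply: nXz; rewrite /X /outside_square /=; tauto.
move=> A A_nonempty [U opU AU] [D clD AD].
have [[x [Xx Ax]]|noXA] := pselect (exists x, X x /\ A x).
  have subXA : X `<=` A.
    suff XE : X `&` A = X by rewrite -XE => y [].
    apply: (connected_outside_square B'0); first by exists x.
    - by exists U => //; rewrite AU setIA (setIidl XK).
    - by exists D => //; rewrite AD setIA (setIidl XK).
  have W0 : ~` K `&` ~` U = set0.
    apply: (@no_bounded_piece _ _ _ _ (B' + B')); first exact: open_closedC.
      rewrite (_ : _ `&` _ = ~` K `&` ~` D).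
        by apply: openI => //; exact: closed_openC.
      apply/seteqP; split=> y [Ky nAy]; split=> // Ay; apply: nAy.
        by have [] : (~` K `&` U) y by rewrite -AU AD.
      by have [] : (~` K `&` D) y by rewrite -AD AU.
    move=> y [Ky Uy]; apply: bounded_of => /subXA.
    by rewrite AU => -[_]; exact: Uy.
  rewrite AU; apply/seteqP; split=> [y []//|y Ky]; split=> //.
  apply: contrapT => nUy; have : (~` K `&` ~` U) y by [].
  by rewrite W0.
exfalso; have W0 : ~` K `&` D = set0.
  apply: (@no_bounded_piece _ _ _ _ (B' + B')) => //.
    by rewrite -AD AU; exact: openI.
  move=> y; rewrite -AD => Ay; apply: bounded_of => Xy; apply: noXA.
  by exists y.
by move: A_nonempty; rewrite AD W0 => -[].
Qed.

(** * The polynomials of the theorem *)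

Lemma bounded_cmodP (R : realType) (a : nat -> Cplx R) :
  bounded_fun a <-> exists B, forall n, cmod (a n) <= B.
Proof.
split=> [/pinfty_ex_gt0[M M0 aM]|[B aB]].
  have M_real : toC (re M) = M by apply: RRe_real; exact: gtr0_real.
  by exists (re M) => n; rewrite -toC_le toC_cmod M_real; exact: aM.
exists (toC B); split; first by apply/complex_realP; exists B.
move=> M BM n _ /=; rewrite -toC_cmod; apply: le_trans (ltW BM).
by rewrite toC_le.
Qed.

Lemma qFS (R : realType) (p : nat -> R) (n : nat) (z : Cplx R) :
  qF p n.+1 z = 1 / toC (r p n.+1) * (qF p n z * qF p n.-1 z)
    - (1 / toC (r p n.+1) - 1).
Proof. by case: n => [|n]; [rewrite -expr2 | rewrite mulrA]. Qed.

Lemma qF_is_poly (R : realType) (p : nat -> R) (n : nat) :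
  exists P : {poly Cplx R}, forall z, P.[z] = qF p n z.
Proof.
(* Two consecutive indices, as the recursion has order two. *)
suff [P [Q [PE _]]] : exists P Q : {poly Cplx R},
    (forall z, P.[z] = qF p n z) /\ (forall z, Q.[z] = qF p n.-1 z).
  by exists P.
elim: n => [|n [P [Q [PE QE]]]].
  pose P : {poly Cplx R} := (toC (p 1%N))^-1 *: ('X - (1 - toC (p 1%N))%:P).
  have PE z : P.[z] = qF p 0 z.
    by rewrite /P /= !hornerE mulrC.
  by exists P, P.
pose c := 1 / toC (r p n.+1).
exists (c *: (P * Q) - (c - 1)%:P), P; split=> // z.
by rewrite qFS hornerD hornerN hornerZ hornerM hornerC PE QE.
Qed.

(** [s w = x - (1 - s)], so [s |w|] lies within [1 - s] of [|x|]; for [|x| >= 1]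
    the lower estimate [|x| - (1 - s)] is at least [s |x|]. *)
Lemma affine_step (R : realType) (s : R) (x : Cplx R) : 0 < s <= 1 ->
  let w := 1 / toC s * x - (1 / toC s - 1) in
  (1 <= cmod x -> cmod x <= cmod w) /\ cmod w <= s^-1 * (cmod x + 1) - 1.
Proof.
move=> /andP[s0 s1] /=; set w := _ - _.
have s_neq0 : toC s != 0 by apply/eqP => -[] /eqP; rewrite gt_eqF.
have E1 : x = toC s * w + toC (1 - s).
  have -> : toC (1 - s) = 1 - toC s by rewrite /toC rmorphB.
  by rewrite /w; field.
have E2 : toC s * w = x + - toC (1 - s) by rewrite {1}E1 addrK.
have cs : cmod (toC s) = s by rewrite cmod_toC gtr0_norm.
have c1s : cmod (toC (1 - s)) = 1 - s by rewrite cmod_toC ger0_norm; lra.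
have lb : cmod x <= s * cmod w + (1 - s).
  by have := cmodD (toC s * w) (toC (1 - s)); rewrite -E1 cmodM cs c1s.
have ub : s * cmod w <= cmod x + (1 - s).
  by have := cmodD x (- toC (1 - s)); rewrite -E2 cmodN cmodM cs c1s.
split=> [x1|].
  by rewrite -(ler_pM2l s0); nra.
rewrite -(ler_pM2l s0) mulrBr mulrA divff ?gt_eqF // mul1r; lra.
Qed.

(** The bound is uniform in the point, which turns the definition of [E] by an
    existential bound into an intersection of sublevel sets. *)
Lemma E_eq_poly_sublevel (R : realType) (p : nat -> R) (delta : R)
    (P : nat -> {poly Cplx R}) :
  0 < delta -> (forall i, (1 <= i)%N -> delta < p i <= 1) ->
  (forall n z, (P n).[z] = qF p n z) ->
  E p = poly_sublevel P (2 * delta^-1 - 1).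
Proof.
move=> d0 dp PE.
have d1 : 1 <= delta^-1.
  by rewrite -[1]invr1 lef_pV2 ?posrE //; have /andP[] := dp 1%N isT; lra.
have dr m : delta < r p m.+1 <= 1 by exact: dp.
apply/seteqP; split=> z.
  move=> /bounded_cmodP[B qB] n; rewrite PE.
  apply: (@bounded_trap R (fun n => cmod (qF p n z)) delta^-1) => //;
    last by exists B.
  - move=> m; exact: cmod_ge0.
  - move=> m; have /andP[rd r1] := dr m.
    rewrite qFS -cmodM; apply: (affine_step _ _).1; lra.
  - move=> m; have /andP[rd r1] := dr m.
    have r01 : 0 < r p m.+1 <= 1 by lra.
    rewrite qFS -cmodM.
    apply: (le_trans (affine_step _ r01).2); rewrite lerD2r ler_wpM2r //.
      by rewrite addr_ge0 ?cmod_ge0.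
    by rewrite lef_pV2 ?posrE; lra.
move=> zP; apply/bounded_cmodP; exists (2 * delta^-1 - 1) => n.
by rewrite -PE.
Qed.

Theorem theorem4p1 (R : realType) (p : nat -> R)
  (hp : forall i : nat, (1 <= i)%N -> 0 < p i <= 1)
  (hdelta : exists2 delta : R, 0 < delta &
              forall i : nat, (1 <= i)%N -> delta < p i) :
  compact (E p) /\ connected (~` E p).
Proof.
case: hdelta => delta d0 dp.
have [P PE] := choice (qF_is_poly p).
have dp1 i : (1 <= i)%N -> delta < p i <= 1.
  by move=> i1; rewrite dp //=; have /andP[] := hp i i1.
rewrite (E_eq_poly_sublevel d0 dp1 PE).
set C := 2 * delta^-1 - 1.
apply: (@compact_connectedC_poly_sublevel _ _ _ _ (C + 1)) => z /(_ 0%N).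
rewrite PE /= => zC.
have /andP[p0 p1] := hp 1%N isT; set s := p 1%N in p0 p1 zC.
have s_neq0 : toC s != 0 by apply/eqP => -[] /eqP; rewrite gt_eqF.
have -> : z = toC s * ((z - (1 - toC s)) / toC s) + toC (1 - s).
  have -> : toC (1 - s) = 1 - toC s by rewrite /toC rmorphB.
  by rewrite mulrC divfK // subrK.
apply: le_trans (cmodD _ _) _; rewrite cmodM !cmod_toC !ger0_norm; try lra.
have := cmod_ge0 ((z - (1 - toC s)) / toC s); nra.
Qed.
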